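(* Let $\mu$ be a Radon measure on $\mathbb{R}^n$, let $s\in[1,n)$, and let $t\in[0,s)$. Then the measure $$\mu^t_{+}:=\mu\llcorner\left\{x\in\mathbb{R}^n: 0<\liminf_{r\downarrow 0} \frac{\mu(B(x,r))}{r^t} \leq \limsup_{r\downarrow 0} \frac{\mu(B(x,r))}{r^t}<\infty\right\}$$ is carried by $(1/s)$-Hölder curves.
   Context: A Radon measure on $\mathbb{R}^n$ is a locally finite Borel regular outer measure. $B(x,r)$ is the closed ball with center $x$ and radius $r$. The restriction $\mu\llcorner E$ is defined by $(\mu\llcorner E)(F)=\mu(E\cap F)$ for all $F\subseteq\mathbb{R}^n$. A $(1/s)$-Hölder curve is a set $f([0,1])\subseteq\mathbb{R}^n$, where $f:[0,1]\to\mathbb{R}^n$ satisfies $\sup_{x\ne y}|f(x)-f(y)|/|x-y|^{1/s}<\infty$. A measure $\nu$ on $\mathbb{R}^n$ is carried by $(1/s)$-Hölder curves if there exist countably many $(1/s)$-Hölder curves $\Gamma_i\subseteq\mathbb{R}^n$ with $\nu(\mathbb{R}^n\setminus\bigcup_i\Gamma_i)=0$. *)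

(* Defs.v *)
From HB Require Import structures.
From mathcomp Require Import all_boot all_order all_algebra.
From mathcomp Require Import all_classical all_reals all_analysis.

Set Implicit Arguments.
Unset Strict Implicit.
Unset Printing Implicit Defensive.
Import Order.TTheory GRing.Theory Num.Theory.
Import numFieldNormedType.Exports.

Local Open Scope classical_set_scope.
Local Open Scope ring_scope.

(* The norm [`|x|] and the sets [ball x r] that the library puts on ['rV[R]_n]
   are those of the sup norm; only the topology is shared with the Euclidean
   norm, hence [eucl_norm] and [eucl_cball]. *)
Definition eucl_norm (R : realType) (n : nat) (x : 'rV[R]_n) : R :=
  Num.sqrt (\sum_(i < n) x ord0 i ^+ 2).

Definition eucl_cball (R : realType) (n : nat) (x : 'rV[R]_n) (r : R) :
  set 'rV[R]_n := [set y | eucl_norm (y - x) <= r].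

Definition borel_set (T : topologicalType) (A : set T) : Prop :=
  <<s [set U : set T | open U] >> A.

Section outer_measures.
Local Open Scope ereal_scope.

Definition locally_finite_outer_measure (R : realType) (T : topologicalType)
    (mu : {outer_measure set T -> \bar R}) : Prop :=
  forall x : T, exists2 U : set T, nbhs x U & mu U < +oo.

Definition borel_regular (R : realType) (T : topologicalType)
    (mu : {outer_measure set T -> \bar R}) : Prop :=
  (forall B : set T, borel_set B -> mu.-caratheodory B) /\
  (forall A : set T, exists B : set T,
    [/\ borel_set B, A `<=` B & mu B = mu A]).

Definition radon_measure (R : realType) (T : topologicalType)
    (mu : {outer_measure set T -> \bar R}) : Prop :=
  locally_finite_outer_measure mu /\ borel_regular mu.

Definition outer_restr (R : realType) (T : Type)
    (mu : {outer_measure set T -> \bar R}) (E : set T) : set T -> \bar R :=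
  fun F => mu (E `&` F).

Section outer_restr_outer_measure.
Context (R : realType) (T : Type).
Variables (mu : {outer_measure set T -> \bar R}) (E : set T).

Let outer_restr0 : outer_restr mu E set0 = 0.
Proof. by rewrite /outer_restr setI0 outer_measure0. Qed.

Let outer_restr_ge0 F : 0 <= outer_restr mu E F.
Proof. exact: outer_measure_ge0. Qed.

Let le_outer_restr : {homo outer_restr mu E : A B / A `<=` B >-> A <= B}.
Proof. by move=> A B AB; apply: le_outer_measure; exact: setIS. Qed.

Let outer_restr_sigma_subadditive : sigma_subadditive (outer_restr mu E).
Proof.
by move=> F; rewrite /outer_restr setI_bigcupr;
  exact: outer_measure_sigma_subadditive.
Qed.

HB.instance Definition _ := isOuterMeasure.Build R T (outer_restr mu E)
  outer_restr0 outer_restr_ge0 le_outer_restr outer_restr_sigma_subadditive.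

End outer_restr_outer_measure.

Definition lower_density (R : realType) (n : nat)
    (mu : {outer_measure set 'rV[R]_n -> \bar R}) (t : R) (x : 'rV[R]_n) :
    \bar R :=
  limf_einf (fun r : R => mu (eucl_cball x r) / (r `^ t)%:E) 0^'+.

Definition upper_density (R : realType) (n : nat)
    (mu : {outer_measure set 'rV[R]_n -> \bar R}) (t : R) (x : 'rV[R]_n) :
    \bar R :=
  limf_esup (fun r : R => mu (eucl_cball x r) / (r `^ t)%:E) 0^'+.

Definition hoelder_on01 (R : realType) (n : nat) (a : R) (f : R -> 'rV[R]_n) :
    Prop :=
  ereal_sup [set q : \bar R | exists x y : R,
    [/\ x \in `[0, 1]%R, y \in `[0, 1]%R, x != y &
        q = (eucl_norm (f x - f y) / `|x - y| `^ a)%:E]] < +oo.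

Definition hoelder_curve (R : realType) (n : nat) (a : R) (G : set 'rV[R]_n) :
    Prop :=
  exists2 f : R -> 'rV[R]_n, hoelder_on01 a f & G = f @` [set` `[0, 1]%R].

Definition carried_by_hoelder_curves (R : realType) (n : nat) (a : R)
    (nu : {outer_measure set 'rV[R]_n -> \bar R}) : Prop :=
  exists C : set (set 'rV[R]_n),
    [/\ countable C, (forall G, C G -> hoelder_curve a G) &
        nu (~` \bigcup_(G in C) G) = 0].

End outer_measures.

(* Main.v *)
(* On the part E of the set where |x| < m and mu(B(x,r)) >= c r^t at all small
   scales, a packing argument shows that E meets at most C 2^(kt) dyadic cubes of
   generation k. Order the points of E lexicographically by their sequences of
   dyadic cubes, and let g(x) be the sum over k of 2^(-ks) times the number of
   generation-k cubes meeting E that strictly precede the cube of x. The sum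
   converges because t < s, and if k is the first generation separating x from
   y then |g(x) - g(y)| >= 2^(-ks), which dominates |x - y|^s up to a constant.
   So g is injective on E, and its inverse, from g(E) to R^n, is
   (1/s)-Hoelder; extending its coordinates by McShane's formula gives a
   (1/s)-Hoelder curve through E. Countably many sets E exhaust the set where
   the lower density is positive. *)

Require Import Defs.
From HB Require Import structures.
From mathcomp Require Import all_boot all_order all_algebra.
From mathcomp Require Import all_classical all_reals all_analysis.
From mathcomp Require Import finmap lra.

Import Order.TTheory GRing.Theory Num.Theory.
Import numFieldNormedType.Exports.

Local Open Scope classical_set_scope.
Local Open Scope ring_scope.

(** * A separating function from ordered codes *)

(** Take for [g x] the weighted sum of the ranks of [code k x] in [L k]. A strict inequality of
    codes persists in later generations, so no earlier one can be reversed: every rank of the larger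
    point dominates, and the rank at generation [k] gains at least one. *)
Lemma lex_rank_embedding (R : realType) (V : Type) (E : set V)
    (code : nat -> V -> nat) (L : nat -> seq nat) (w : nat -> R) (M : R) :
  (forall k, 0 <= w k) ->
  (forall k x y, (code k x < code k y)%N -> (code k.+1 x < code k.+1 y)%N) ->
  (forall k x, E x -> code k x \in L k) ->
  (forall K, \sum_(k < K) w k * (size (L k))%:R <= M) ->
  exists2 g : V -> R, (forall x, 0 <= g x <= M) &
    forall k x y, E x -> E y -> code k x != code k y -> w k <= `|g x - g y|.
Proof.
move=> w0 mono codeL wM.
pose r k x : nat := count (fun c => (c < code k x)%N) (L k).
pose S x K := \sum_(k < K) w k * (r k x)%:R.
have S0 x K : 0 <= S x K by apply: sumr_ge0 => i _; exact: mulr_ge0.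
have SM x K : S x K <= M.
  apply: le_trans (wM K); apply: ler_sum => i _.
  by apply: ler_wpM2l => //; rewrite ler_nat count_size.
have Sub x : has_ubound (range (S x)) by exists M => _ [K _ <-].
have Snd x : {homo S x : i j / (i <= j)%N >-> i <= j}.
  move=> i j ij; rewrite /S -!(big_mkord xpredT (fun k => w k * (r k x)%:R)).
  rewrite (big_cat_nat (leq0n i) ij) /= lerDl.
  by apply: sumr_ge0 => k _; exact: mulr_ge0.
exists (fun x => sup (range (S x))).
  move=> x; apply/andP; split.
    by apply: (le_trans (S0 x 0%N)); apply: ub_le_sup => //; exists 0%N.
  by apply: ge_sup; [exists (S x 0%N), 0%N | move=> _ [K _ <-]].
suff H k x y : E x -> E y -> (code k x < code k y)%N ->
    w k <= sup (range (S y)) - sup (range (S x)).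
  move=> k x y Ex Ey; rewrite neq_ltn => /orP[xy|yx].
    by rewrite distrC; apply: le_trans (ler_norm _); exact: H.
  by apply: le_trans (ler_norm _); exact: H.
move=> Ex Ey xy.
have lt_code j : (k <= j)%N -> (code j x < code j y)%N.
  move=> /subnK <-; elim: (j - k)%N => [//|d IH].
  by rewrite addSn; exact: mono.
have le_code j : (code j x <= code j y)%N.
  have [/lt_code/ltnW //|jk] := leqP k j.
  rewrite leqNgt; apply/negP => yx.
  have : (code k y < code k x)%N.
    rewrite -(subnK (ltnW jk)); elim: (k - j)%N => [//|d IH].
    by rewrite addSn; exact: mono.
  by rewrite ltnNge (ltnW xy).
have le_r j : (r j x <= r j y)%N.
  by apply: sub_count => c /= /leq_trans; apply.
(* The entry [code k x] of [L k] counts for [y] but not for [x]. *)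
have lt_r : (r k x < r k y)%N.
  have /count_memPn/eqP := codeL k x Ex.
  rewrite -lt0n => cx; rewrite -(addn1 (r k x)).
  apply: (@leq_trans (r k x + count_mem (code k x) (L k))%N).
    by rewrite leq_add2l.
  rewrite -count_predUI [X in (_ + X)%N](_ : _ = 0%N) ?addn0.
    apply: sub_count => c /= /orP[/ltn_trans|/eqP ->//]; exact.
  apply/eqP; rewrite -leqn0 leqNgt -has_count; apply/hasPn => c _ /=.
  by case: eqP => [->|]; rewrite ?ltnn ?andbF.
rewrite lerBrDr -lerBrDl; apply: ge_sup; first by exists (S x 0%N), 0%N.
(* Lengthening the partial sum makes it contain the term of generation [k]. *)
move=> _ [K _ <-]; apply: (le_trans (Snd x _ _ (leq_maxl K k.+1))).
set N := maxn _ _; rewrite lerBrDl.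
apply: (@le_trans _ _ (S y N)); last by apply: ub_le_sup => //; exists N.
have kN : (k < N)%N by rewrite /N leq_max leqnn orbT.
rewrite /S (bigD1 (Ordinal kN)) //= [X in _ <= X](bigD1 (Ordinal kN)) //= addrA.
apply: lerD; last by apply: ler_sum => i _; rewrite ler_wpM2l// ler_nat.
by rewrite -[X in X + _]mulr1 -mulrDr ler_wpM2l// addrC natr1 ler_nat.
Qed.

(** * Extension of Hoelder functions on the line *)

(** A number in [0, 1] is at most its [a]-th power; apply this to [x / (x + y)] and [y / (x + y)],
    whose sum is 1. *)
Lemma powR_subadditive (R : realType) (a x y : R) :
  0 < a <= 1 -> 0 <= x -> 0 <= y -> (x + y) `^ a <= x `^ a + y `^ a.
Proof.
move=> /andP[a0 a1] x0 y0.
have [->|xy0] := eqVneq (x + y) 0.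
  by rewrite powR0 ?gt_eqF// addr_ge0 ?powR_ge0.
have {xy0}xy : 0 < x + y by rewrite lt_def xy0 addr_ge0.
have H z : 0 <= z -> z <= x + y -> z / (x + y) <= z `^ a / (x + y) `^ a.
  move=> z0 zxy.
  have -> : z `^ a / (x + y) `^ a = (z / (x + y)) `^ a.
    rewrite powRM ?invr_ge0 ?(ltW xy)// -(powR_inv1 (ltW xy)) powRAC.
    by rewrite powR_inv1// powR_ge0.
  have [->|z_neq0] := eqVneq z 0; first by rewrite !mul0r powR_ge0.
  apply: ger1_powR => //.
  by rewrite ler_pdivrMr// mul1r zxy divr_gt0// lt_def z_neq0.
have := lerD (H x x0 _) (H y y0 _).
rewrite -!mulrDl divff ?gt_eqF// lerDl lerDr => /(_ y0 x0).
by rewrite ler_pdivlMr ?mul1r// powR_gt0.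
Qed.

(** What is extended is [phi] read as a function of [h]: points of [E] with equal [h] have equal
    [phi], because [a] is positive. Subadditivity of the power gives the triangle inequality behind
    the extension. *)
Lemma hoelder_extension (R : realType) (V : Type) (E : set V) (phi h : V -> R)
    (C a : R) : 0 < a <= 1 -> 0 <= C ->
  (forall x y, E x -> E y -> `|phi x - phi y| <= C * `|h x - h y| `^ a) ->
  exists2 f : R -> R, (forall x, E x -> f (h x) = phi x) &
    forall u v, `|f u - f v| <= C * `|u - v| `^ a.
Proof.
move=> a01 C0 Hphi.
have a0 : a != 0 by case/andP: a01 => /lt0r_neq0.
have [[e0 Ee0]|E0] := pselect (E !=set0); last first.
  exists (fun=> 0) => [x Ex|u v]; first by exfalso; apply: E0; exists x.
  by rewrite subrr normr0 mulr_ge0// powR_ge0.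
(* McShane's extension: the infimum of [F u] over [E]. *)
pose F u e := phi e + C * `|u - h e| `^ a.
have F_le u v e : F u e <= F v e + C * `|u - v| `^ a.
  rewrite /F -addrA lerD2l -mulrDr ler_wpM2l//.
  apply: le_trans (powR_subadditive _ _ _ _ a01 (normr_ge0 _) (normr_ge0 _)).
  apply: ge0_ler_powR; rewrite ?nnegrE ?addr_ge0//; first by case/andP: a01 => /ltW.
  by rewrite (_ : u - h e = (v - h e) + (u - v)) ?ler_normD//; lra.
have F_ge e e' : E e -> E e' -> phi e <= F (h e) e'.
  move=> Ee Ee'; rewrite /F -lerBlDl.
  by apply: le_trans (Hphi _ _ Ee Ee'); exact: ler_norm.
have lbF u : has_lbound (F u @` E).
  exists (phi e0 - C * `|h e0 - u| `^ a) => _ [e Ee <-].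
  rewrite lerBlDr; apply: le_trans (F_le (h e0) u e); exact: F_ge.
pose f u := inf (F u @` E).
have f_le u v : f u <= f v + C * `|u - v| `^ a.
  rewrite -lerBlDr; apply: lb_le_inf; first by exists (F v e0), e0.
  move=> _ [e Ee <-]; rewrite lerBlDr.
  apply: le_trans (F_le u v e); apply: ge_inf => //; by exists e.
exists f => [x Ex|u v].
  apply/eqP; rewrite eq_le; apply/andP; split.
    apply: ge_inf => //; exists x => //.
    by rewrite /F subrr normr0 powR0// mulr0 addr0.
  apply: lb_le_inf; first by exists (F (h x) x), x.
  move=> _ [e Ee <-]; exact: F_ge.
rewrite ler_norml lerBlDl f_le andbT lerBrDl lerBlDr.
by rewrite distrC f_le.
Qed.

(** * Coordinates and integer parts *)

Lemma coord_le_eucl_norm (R : realType) (n : nat) (v : 'rV[R]_n) (i : 'I_n) :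
  `|v ord0 i| <= eucl_norm v.
Proof.
rewrite -sqrtr_sqr /eucl_norm ler_wsqrtr// (bigD1 i)//= lerDl.
by apply: sumr_ge0 => j _; exact: sqr_ge0.
Qed.

Lemma eucl_norm_le_coord (R : realType) (n : nat) (v : 'rV[R]_n) (c : R) :
  0 <= c -> (forall i, `|v ord0 i| <= c) -> eucl_norm v <= Num.sqrt n%:R * c.
Proof.
move=> c0 vc; rewrite -(ger0_norm c0) -sqrtr_sqr -sqrtrM//.
rewrite /eucl_norm ler_wsqrtr// mulr_natl -[n in _ *+ n]card_ord -sumr_const.
apply: ler_sum => i _; rewrite -real_normK ?num_real//.
by rewrite lerXn2r ?nnegrE.
Qed.

(** Doubling appends one binary digit; this makes dyadic cells nest, with the parity as the new
    digit. *)
Lemma half_truncn_double (R : realType) (u : R) : 0 <= u ->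
  (Num.trunc (2 * u))./2 = Num.trunc u.
Proof.
move=> u0; apply/esym/truncn_def.
have /truncn_itv/andP[] : 0 <= 2 * u by rewrite mulr_ge0.
set q := Num.trunc _; rewrite -{1 2}(odd_double_half q).
set h := q./2; rewrite -!natr1 natrD -muln2 natrM.
by case: (odd q) => /= h1 h2; apply/andP; split; lra.
Qed.

Lemma truncn_eq_dist (R : realType) (u v : R) : 0 <= u -> 0 <= v ->
  Num.trunc u = Num.trunc v -> `|u - v| < 1.
Proof.
move=> /truncn_itv/andP[u1 u2] /truncn_itv/andP[v1 v2] uv.
move: u1 u2; rewrite uv -natr1 in v2 * => u1 u2.
by rewrite ltr_norml; apply/andP; split; lra.
Qed.

(** Distinct integers of equal parity are at least two apart. *)
Lemma truncn_parity_dist (R : realType) (u v : R) : 0 <= u -> 0 <= v ->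
  odd (Num.trunc u) = odd (Num.trunc v) -> Num.trunc u != Num.trunc v ->
  1 < `|u - v|.
Proof.
wlog uv : u v / (Num.trunc u < Num.trunc v)%N.
  move=> H u0 v0 o; rewrite neq_ltn => /orP[uv|vu].
    by apply: H => //; rewrite ltn_eqF.
  by rewrite distrC; apply: H => //; rewrite ltn_eqF.
move=> /truncn_itv/andP[_ u2] /truncn_itv/andP[v1 _] o _.
have : ((Num.trunc u).+2 <= Num.trunc v)%N.
  rewrite ltn_neqAle uv andbT; apply: contra_eqN o => /eqP <- /=.
  by case: odd.
rewrite -(ler_nat R) -natr1 => uv2.
by rewrite ltr_normr; apply/orP; right; lra.
Qed.

(** * Compact sets, packing and density bounds *)

Lemma outer_measure_compact_fin (R : realType) (T : ptopologicalType)
    (mu : {outer_measure set T -> \bar R}) (K : set T) :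
  locally_finite_outer_measure mu -> compact K -> (mu K < +oo)%E.
Proof.
move=> mufin; rewrite compact_cover => Kcov.
have [U HU] := choice (fun x => (let: ex_intro2 U xU muU := mufin x in
  ex_intro (fun U => nbhs x U /\ mu U < +oo)%E U (conj xU muU))).
have [D _ KD] : finite_subset_cover setT (fun x => (U x)^°) K.
  apply: Kcov => [x _|x _]; first exact: open_interior.
  by exists x => //; have [] := HU x.
apply: (le_lt_trans (le_outer_measure mu _ _ KD)).
have -> : cover [set` D] (fun x => (U x)^°) =
    \big[setU/set0]_(x <- enum_fset D) (U x)^°.
  by rewrite /cover bigcup_fset.
elim: (enum_fset D) => [|x s IH]; first by rewrite big_nil outer_measure0.
rewrite big_cons; apply: (le_lt_trans (outer_measureU2 mu _ _)).
apply: lte_add_pinfty => //; apply: le_lt_trans (HU x).2.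
by apply: le_outer_measure; exact: interior_subset.
Qed.

(** Induction on [s] with [X] varying: the Caratheodory condition for the first set splits [mu X],
    and the other sets, disjoint from it, lie in the rest of [X]. *)
Lemma packing_bound (R : realType) (T : Type) (I : eqType)
    (mu : {outer_measure set T -> \bar R}) (s : seq I) (U : I -> set T)
    (X : set T) (c : R) :
  uniq s -> 0 <= c ->
  {in s &, forall i j, i != j -> U i `&` U j = set0} ->
  {in s, forall i, [/\ mu.-caratheodory (U i), U i `<=` X &
    (c%:E <= mu (U i))%E]} ->
  (((size s)%:R * c)%:E <= mu X)%E.
Proof.
move=> + c0; elim: s X => [|i s IH] X /=; first by rewrite mul0r outer_measure_ge0.
move=> /andP[is_ us] disj HU.
have [cU UX cle] := HU i (mem_head _ _).
rewrite (cU X) setIidr// -natr1 mulrDl mul1r addrC EFinD leeD//.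
apply: IH => // [j k js ks|j js].
  by apply: disj; rewrite in_cons ?js ?ks orbT.
have [cUj UjX cj] := HU j (mem_behead (s := i :: s) js); split => //.
rewrite subsetI; split => //; apply/disjoints_subset.
apply: disj; rewrite ?mem_head//; first by rewrite in_cons js orbT.
by apply: contraNneq is_ => <-.
Qed.

Lemma lower_densityP (R : realType) (n : nat)
    (mu : {outer_measure set 'rV[R]_n -> \bar R}) (t : R) (x : 'rV[R]_n) :
  (0 < lower_density mu t x)%E ->
  exists2 c : R, 0 < c & exists2 d : R, 0 < d &
    forall r, 0 < r -> r < d -> ((c * r `^ t)%:E <= mu (eucl_cball x r))%E.
Proof.
rewrite /lower_density /limf_einf oppe_gt0 => /ereal_inf_lt[_ [V FV <-]].
move=> supV.
have [c c0 Hc] : exists2 c : R, 0 < c &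
    forall r, V r -> (c%:E <= mu (eucl_cball x r) / (r `^ t)%:E)%E.
  have ubV r : V r -> (- (mu (eucl_cball x r) / (r `^ t)%:E) <=
    ereal_sup ((\- (fun r : R => mu (eucl_cball x r) / (r `^ t)%:E)) @` V))%E.
    by move=> Vr; apply: ereal_sup_ubound; exists r.
  (* If the supremum is -oo, the ratio is infinite throughout [V] and any constant, here 1,
     serves. *)
  move: supV ubV; case: (ereal_sup _) => [b| |] // b0 ubV.
    exists (- b); first by rewrite oppr_gt0 -lte_fin.
    by move=> r /ubV; rewrite leeNl.
  by exists 1 => // r /ubV; rewrite leeNl => /(le_trans _); apply; rewrite leey.
move: FV => [d /= d0 Hd].
exists c => //; exists d => // r r0 rd.
have Vr : V r by apply: (Hd r _ r0); rewrite /= sub0r normrN gtr0_norm.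
have := Hc r Vr.
have rt0 : 0 < r `^ t by exact: powR_gt0.
by rewrite inver gt_eqF// lee_pdivlMr// EFinM.
Qed.

(** * Dyadic cells and their lexicographic codes *)

(** The affine map carries (-m, m) to (0, 1), so cells of generation [k] have side
    [2 * m / 2 ^+ k]. *)
Definition dyadic {R : realType} {n : nat} (m : R) (k : nat) (x : 'rV[R]_n)
    (i : 'I_n) : nat :=
  Num.trunc (2 ^+ k * ((x ord0 i + m) / (2 * m))).

Definition dyadic_digit {R : realType} {n : nat} (m : R) (k : nat)
    (x : 'rV[R]_n) : {ffun 'I_n -> bool} := [ffun i => odd (dyadic m k x i)].

(* The codes of generation [k] are ordered as the length-[k] digit sequences are
   lexicographically; on the cube [(-m, m)^n] they determine the dyadic cube. *)
Fixpoint dyadic_code {R : realType} {n : nat} (m : R) (k : nat)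
    (x : 'rV[R]_n) : nat :=
  if k is k'.+1 then
    (#|{: {ffun 'I_n -> bool}}| * dyadic_code m k' x +
      enum_rank (dyadic_digit m k x))%N
  else 0%N.

Section dyadic_code_theory.
Context (R : realType) (n : nat) (m : R).
Hypothesis m0 : 0 < m.
Implicit Types (x y : 'rV[R]_n) (k : nat).
Let cube x := forall i, `|x ord0 i| < m.
Let B := #|{: {ffun 'I_n -> bool}}|.

Let scaled_ge0 k x i : cube x -> 0 <= 2 ^+ k * ((x ord0 i + m) / (2 * m)).
Proof.
move=> /(_ i); rewrite ltr_norml => /andP[xm _].
rewrite mulr_ge0 ?exprn_ge0// divr_ge0 ?(ltW (mulr_gt0 _ m0))//. lra.
Qed.

Let scaled_dist k x y i :
  `|2 ^+ k * ((x ord0 i + m) / (2 * m)) - 2 ^+ k * ((y ord0 i + m) / (2 * m))| =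
  `|x ord0 i - y ord0 i| / (2 * m / 2 ^+ k).
Proof.
have m2 : 0 < 2 * m by rewrite mulr_gt0.
rewrite -mulrBr -mulrBl opprD addrACA subrr addr0 !normrM invf_div.
by rewrite (ger0_norm (exprn_ge0 _ _))// normfV (gtr0_norm m2) mulrCA.
Qed.

Let mesh_gt0 k : 0 < 2 * m / 2 ^+ k.
Proof. by rewrite divr_gt0 ?mulr_gt0 ?exprn_gt0. Qed.

Lemma dyadic0 x i : cube x -> dyadic m 0 x i = 0%N.
Proof.
move=> /(_ i); rewrite ltr_norml => /andP[xm1 xm2].
apply/truncn_def; rewrite expr0 mul1r divr_ge0 /=; first 1 last; try lra.
by rewrite ltr_pdivrMr; lra.
Qed.

Lemma half_dyadicS k x i : cube x -> (dyadic m k.+1 x i)./2 = dyadic m k x i.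
Proof.
by move=> cx; rewrite /dyadic exprS -mulrA half_truncn_double ?scaled_ge0.
Qed.

Lemma dyadic_eq_dist k x y i : cube x -> cube y ->
  dyadic m k x i = dyadic m k y i -> `|x ord0 i - y ord0 i| < 2 * m / 2 ^+ k.
Proof.
move=> cx cy.
move=> /(truncn_eq_dist _ _ _ (scaled_ge0 k x i cx) (scaled_ge0 k y i cy)).
by rewrite scaled_dist ltr_pdivrMr// mul1r.
Qed.

Lemma dyadic_parity_dist k x y i : cube x -> cube y ->
  odd (dyadic m k x i) = odd (dyadic m k y i) ->
  dyadic m k x i != dyadic m k y i ->
  2 * m / 2 ^+ k < `|x ord0 i - y ord0 i|.
Proof.
move=> cx cy o.
move=> /(truncn_parity_dist _ _ _ (scaled_ge0 k x i cx) (scaled_ge0 k y i cy) o).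
by rewrite scaled_dist ltr_pdivlMr// mul1r.
Qed.

(** The code is a numeral in base [B], and a last digit below [B] cannot make up for a difference in
    the preceding ones. *)
Lemma dyadic_code_mono k x y : (dyadic_code m k x < dyadic_code m k y)%N ->
  (dyadic_code m k.+1 x < dyadic_code m k.+1 y)%N.
Proof.
move=> xy /=; apply: leq_trans (leq_addr _ _).
apply: (@leq_trans (B * (dyadic_code m k x).+1)); last by rewrite leq_mul2l xy orbT.
by rewrite mulnSr ltn_add2l ltn_ord.
Qed.

Lemma dyadic_code_bound k x : (dyadic_code m k x < B ^ k)%N.
Proof.
elim: k => [|k IH] /=; first by rewrite expn0.
rewrite expnS; apply: (@leq_trans (B * (dyadic_code m k x).+1)).
  by rewrite mulnSr ltn_add2l ltn_ord.
by rewrite leq_mul2l IH orbT.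
Qed.

(** Division by [B] recovers the preceding code, and the rest gives the parities; half and parity
    determine each index. *)
Lemma dyadic_code_inj k x y : cube x -> cube y ->
  dyadic_code m k x = dyadic_code m k y -> dyadic m k x =1 dyadic m k y.
Proof.
move=> cx cy; elim: k => [_ i|k IH e i]; first by rewrite !dyadic0.
have B0 : (0 < B)%N by apply/card_gt0P; exists [ffun=> false].
have e1 : dyadic_code m k x = dyadic_code m k y.
  have := congr1 (divn ^~ B) e.
  by rewrite /= !(mulnC #|_|) !divnMDl// !divn_small ?ltn_ord// !addn0.
move: e; rewrite /= e1 => /addnI/val_inj/enum_rank_inj/ffunP/(_ i).
rewrite !ffunE => o.
by rewrite -[LHS]odd_double_half -[RHS]odd_double_half o !half_dyadicS// IH.
Qed.

Lemma eq_dyadic_code k x y : cube x -> cube y ->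
  dyadic m k x =1 dyadic m k y -> dyadic_code m k x = dyadic_code m k y.
Proof.
move=> cx cy; elim: k => [//|k IH] e /=; congr (_ * _ + _)%N.
  by apply: IH => i; rewrite -(half_dyadicS _ _ _ cx) -(half_dyadicS _ _ _ cy) e.
by congr (nat_of_ord (enum_rank _)); apply/ffunP => i; rewrite !ffunE e.
Qed.

End dyadic_code_theory.

(** * Counting the dyadic cubes that meet [E] *)

(** Within each class of codes with a common last digit, points of [E] carry disjoint balls of mass
    at least a / 2^(kt) in the bounded cube [Q], so the class has at most (W / a) 2^(kt) members. *)
Lemma dyadic_code_count (R : realType) (n : nat)
    (mu : {outer_measure set 'rV[R]_n -> \bar R}) (t m c d : R)
    (E : set 'rV[R]_n) :
  radon_measure mu -> 0 < m -> 0 < c -> 0 < d <= m ->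
  (forall x, E x -> forall i, `|x ord0 i| < m) ->
  (forall x r, E x -> 0 < r -> r < d ->
    ((c * r `^ t)%:E <= mu (eucl_cball x r))%E) ->
  exists2 K : R, 0 <= K & forall k, exists2 L : seq nat,
    (forall x, E x -> dyadic_code m k x \in L) &
    (size L)%:R <= K * (2 `^ t) ^+ k.
Proof.
move=> [mufin [muborel _]] m0 c0 /andP[d0 dm] Em Emu.
pose Q : set 'rV[R]_n := [set y | forall i, `[- (2 * m), 2 * m]%classic (y ord0 i)].
have muQ : (mu Q < +oo)%E.
  apply: outer_measure_compact_fin => //.
  apply: (@rV_compact _ _ (fun=> `[- (2 * m), 2 * m]%classic)) => i.
  exact: segment_compact.
have muQf : mu Q \is a fin_num by rewrite ge0_fin_numE// outer_measure_ge0.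
pose W := fine (mu Q).
have W0 : 0 <= W by rewrite fine_ge0// outer_measure_ge0.
(* The mass bound is applied at radius (d / 2) / 2^k, which is below [d] even for k = 0; [a] is its
   value there. *)
pose a := c * (d / 2) `^ t.
have a0 : 0 < a by rewrite mulr_gt0// powR_gt0// divr_gt0.
pose P := {ffun 'I_n -> bool}.
exists (#|{: P}|%:R * (W / a)); first by rewrite mulr_ge0// divr_ge0// ltW.
move=> k.
pose L := [seq q <- iota 0 (#|{: P}| ^ k) |
            `[< exists2 x, E x & dyadic_code m k x = q >] ].
have uL : uniq L by rewrite filter_uniq// iota_uniq.
exists L.
  move=> x Ex; rewrite mem_filter mem_iota /= add0n dyadic_code_bound andbT.
  by apply/asboolP; exists x.
have /choice[rep Hrep] (q : nat) : exists x, q \in L ->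
    E x /\ dyadic_code m k x = q.
  have [|nq] := boolP (q \in L); last by exists 0.
  by rewrite mem_filter => /andP[/asboolP[x Ex xq] _]; exists x.
(* Distinct cubes with the same last digit are separated by a full mesh width, so
   that balls around points chosen in them are disjoint. *)
pose p q : P := dyadic_digit m k (rep q).
have tk0 : 0 < 2 `^ t ^+ k :> R by rewrite exprn_gt0// powR_gt0.
have class_le z : (count (fun q => p q == z) L)%:R <= (W / a) * (2 `^ t) ^+ k.
  rewrite -size_filter; set s := [seq q <- L | p q == z].
  have sL q : q \in s -> [/\ q \in L, E (rep q), dyadic_code m k (rep q) = q & p q = z].
    by rewrite mem_filter => /andP[/eqP pq qL]; have [] := Hrep q qL.
  have e0 : 0 < m / 2 ^+ k by rewrite divr_gt0// exprn_gt0.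
  have : (((size s)%:R * (a / 2 `^ t ^+ k))%:E <= mu Q)%E.
    apply: (@packing_bound _ _ _ _ _ (fun q => ball (rep q) (m / 2 ^+ k))).
    - by rewrite filter_uniq.
    - by rewrite divr_ge0// ltW.
    - move=> q q' /sL[qL Eq cq pq] /sL[q'L Eq' cq' pq'] qq'.
      apply/disjoints_subset => y [_ yq] [_ yq'].
      have [i Hi] : exists i, dyadic m k (rep q) i != dyadic m k (rep q') i.
        apply/existsP; rewrite -negb_forall; apply: contra_neqN qq' => /forallP H.
        rewrite -cq -cq'; apply: eq_dyadic_code => //; try exact: Em.
        by move=> i; apply/eqP.
      have o : odd (dyadic m k (rep q) i) = odd (dyadic m k (rep q') i).
        by have /ffunP/(_ i) := etrans pq (esym pq'); rewrite !ffunE.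
      have := dyadic_parity_dist _ _ _ m0 _ _ _ _ (Em _ Eq) (Em _ Eq') o Hi.
      apply/negP; rewrite -leNgt.
      have := yq ord0 i; have := yq' ord0 i; rewrite /ball/= => h1 h2.
      rewrite -[X in `|X|](subrKA (y ord0 i)).
      apply: (le_trans (ler_normD _ _)); rewrite (distrC (y _ _)).
      by rewrite -mulrA mulr2n mulrDl mul1r lerD// ltW.
    - move=> q /sL[qL Eq cq pq]; split.
      + by apply: muborel; apply: sub_sigma_algebra; exact: ball_open.
      + move=> y [_ yq] i; have := yq ord0 i; rewrite /ball/= => yi.
        rewrite in_itv/= -ler_norml.
        have mk : m / 2 ^+ k <= m.
          by rewrite ler_pdivrMr ?exprn_gt0// ler_peMr ?exprn_ege1 ?ler1n// ltW.
        have := Em _ Eq i; have := ler_normD (rep q ord0 i) (y ord0 i - rep q ord0 i).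
        by rewrite addrC subrK (distrC (y _ _)); lra.
      + have r0 : 0 < d / 2 / 2 ^+ k by rewrite !divr_gt0// exprn_gt0.
        have d2 : d / 2 < d by lra.
        have := Emu (rep q) (d / 2 / 2 ^+ k) Eq r0.
        have rd : d / 2 / 2 ^+ k <= d / 2.
          by rewrite ler_pdivrMr ?exprn_gt0// ler_peMr ?exprn_ege1 ?ler1n// divr_ge0 ?ltW.
        move=> /(_ (le_lt_trans rd d2)).
        have -> : c * (d / 2 / 2 ^+ k) `^ t = a / 2 `^ t ^+ k.
          rewrite powRM ?invr_ge0 ?exprn_ge0 ?divr_ge0 ?ltW// mulrA; congr (_ * _).
          rewrite -powR_inv1 ?exprn_ge0// powRAC powR_inv1 ?powR_ge0//; congr (_^-1).
          by rewrite -powR_mulrn// powRAC powR_mulrn// powR_ge0.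
        (* The closed Euclidean ball fits in the open sup-norm ball because [d / 2 < m]. *)
        move=> /le_trans; apply; apply: le_outer_measure => y yq; split => // j i.
        rewrite ord1 /ball/= distrC.
        have := coord_le_eucl_norm _ _ (y - rep q) i; rewrite !mxE => /le_lt_trans; apply.
        apply: (le_lt_trans yq); rewrite ltr_pM2r ?invr_gt0 ?exprn_gt0//; lra.
  rewrite -(fineK muQf) lee_fin mulrA ler_pdivrMr// -ler_pdivlMr//.
  by rewrite mulrAC.
have -> : size L = (\sum_(z : P) count (fun q => p q == z) L)%N.
  rewrite -sum1_size (partition_big p xpredT)//=.
  by apply: eq_bigr => z _; rewrite -sum1_count.
rewrite natr_sum -mulrA mulr_natl -sumr_const; apply: ler_sum => z _.
exact: class_le.
Qed.

(** * A Hoelder curve through [E] *)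

Lemma geometric_sum_le (R : realType) (q : R) (k : nat) : 0 <= q -> q < 1 ->
  \sum_(i < k) q ^+ i <= (1 - q)^-1.
Proof.
move=> q0 q1; have q1' : 0 < 1 - q by rewrite subr_gt0.
rewrite -[leRHS]mul1r ler_pdivlMr// mulrC -opprB mulNr -subrX1 opprB.
by rewrite gerBl exprn_ge0.
Qed.

Lemma sub_hoelder_curve (R : realType) (n : nat)
    (mu : {outer_measure set 'rV[R]_n -> \bar R}) (s t m c d : R)
    (E : set 'rV[R]_n) :
  radon_measure mu -> 1 <= s -> t < s -> 0 < m -> 0 < c -> 0 < d <= m ->
  (forall x, E x -> forall i, `|x ord0 i| < m) ->
  (forall x r, E x -> 0 < r -> r < d ->
    ((c * r `^ t)%:E <= mu (eucl_cball x r))%E) ->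
  exists2 G, hoelder_curve (1 / s) G & E `<=` G.
Proof.
move=> muR s1 ts m0 c0 dm Em Emu.
have [K K0 /choice[L HL]] : exists2 K : R, 0 <= K & forall k, exists L : seq nat,
    (forall x, E x -> dyadic_code m k x \in L) /\
    (size L)%:R <= K * (2 `^ t) ^+ k.
  have [K K0 HK] := dyadic_code_count _ _ _ _ _ _ _ _ muR m0 c0 dm Em Emu.
  by exists K => // k; have [L] := HK k; exists L.
(* Weights 2^(-ks) against at most K 2^(kt) codes give a geometric series of ratio [q], below 1
   since [t < s]. *)
pose w k : R := (2 `^ (- s)) ^+ k.
pose q : R := 2 `^ (- s) * 2 `^ t.
have q0 : 0 <= q by rewrite mulr_ge0// powR_ge0.
have q1 : q < 1.
  rewrite /q -powRD ?pnatr_eq0 ?implybT// addrC powRB ?pnatr_eq0 ?implybT//.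
  rewrite ltr_pdivrMr ?powR_gt0// mul1r /powR pnatr_eq0/= ltr_expR.
  by rewrite ltr_pM2r// ln_gt0// ltr1n.
pose M := K * (1 - q)^-1.
have M0 : 0 <= M by rewrite mulr_ge0// invr_ge0 subr_ge0 ltW.
have wM k : \sum_(i < k) w i * (size (L i))%:R <= M.
  apply: (@le_trans _ _ (\sum_(i < k) K * q ^+ i)).
    apply: ler_sum => i _; rewrite exprMn mulrCA ler_wpM2l ?exprn_ge0 ?powR_ge0//.
    exact: (HL i).2.
  by rewrite -mulr_sumr ler_wpM2l// geometric_sum_le.
have w0 k : 0 <= w k by rewrite exprn_ge0// powR_ge0.
have [g g01 gw] := lex_rank_embedding _ _ E _ _ _ _ w0
  (fun k x y => dyadic_code_mono _ _ m k x y)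
  (fun k x (Ex : E x) => (HL k).1 x Ex) wM.
pose a := 1 / s.
have s0 : 0 < s by lra.
have a01 : 0 < a <= 1 by rewrite divr_gt0// ler_pdivrMr// mul1r.
have M1 : 0 < M + 1 by lra.
(* The divisor is [M + 1] because [M] may vanish. *)
pose h x := g x / (M + 1).
have h01 x : h x \in `[0, 1].
  have /andP[g0 gM] := g01 x; rewrite in_itv/= divr_ge0 ?(ltW M1)//=.
  by rewrite ler_pdivrMr// mul1r; lra.
(* The mesh 2m / 2^k equals 4m / 2^(k+1), and 1 / 2^(k+1) is the [a]-th power of [w k.+1]; the other
   factor undoes the division by [M + 1]. *)
pose C := 4 * m * (M + 1) `^ a.
have C0 : 0 <= C by rewrite mulr_ge0 ?powR_ge0// mulr_ge0// ltW.
have hE i x y : E x -> E y -> `|x ord0 i - y ord0 i| <= C * `|h x - h y| `^ a.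
  move=> Ex Ey; have [->|xy] := eqVneq (x ord0 i) (y ord0 i).
    by rewrite subrr normr0 mulr_ge0// powR_ge0.
  have xy0 : 0 < `|x ord0 i - y ord0 i| by rewrite normr_gt0 subr_eq0.
  have exk : exists k, dyadic_code m k x != dyadic_code m k y.
    apply: contrapT => nk.
    set e := `|_ - _| in xy0.
    (* This [k] exceeds [2 * m / e] and 2^k is at least [k], so the mesh of generation [k] is at
       most [e]. *)
    pose k := (Num.trunc (2 * m / e)).+1.
    have : `|x ord0 i - y ord0 i| < 2 * m / 2 ^+ k.
      apply: dyadic_eq_dist; rewrite ?Em//; try exact: Em.
      apply: (dyadic_code_inj _ _ _ m0 k _ _ (Em _ Ex) (Em _ Ey)).
      by apply/eqP/negPn/negP => Hk; apply: nk; exists k.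
    apply/negP; rewrite -leNgt -/e ler_pdivrMr ?exprn_gt0// -ler_pdivrMl// mulrC.
    have k2 : k%:R <= 2 ^+ k :> R by rewrite -natrX ler_nat ltnW// ltn_expl.
    exact: le_trans (ltW (truncnS_gt _)) k2.
  (* Codes of generation 0 all agree, so the first separating generation is a successor [k.+1]: the
     common cell of generation [k] bounds the distance, and [w k.+1] bounds the gap of [g] from
     below. *)
  case: (ex_minnP exk) => -[|k]; first by rewrite eqxx.
  move=> kxy kmin; have := gw _ _ _ Ex Ey kxy.
  have ek : dyadic_code m k x = dyadic_code m k y.
    by apply/eqP/negPn/negP => /kmin; rewrite ltnn.
  have /ltW dk := dyadic_eq_dist _ _ _ m0 k _ _ i (Em _ Ex) (Em _ Ey)
    (dyadic_code_inj _ _ _ m0 k _ _ (Em _ Ex) (Em _ Ey) ek i).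
  have -> : g x - g y = (M + 1) * (h x - h y).
    by rewrite /h -mulrBl mulrC divfK// gt_eqF.
  rewrite normrM (gtr0_norm M1) => wk.
  have : w k.+1 `^ a <= ((M + 1) * `|h x - h y|) `^ a.
    apply: ge0_ler_powR; rewrite // ?nnegrE //; first by case/andP: a01 => /ltW.
    by rewrite mulr_ge0// ltW.
  have -> : w k.+1 `^ a = 2 ^- k.+1.
    have ska : - s * k.+1%:R * a = - k.+1%:R.
      by rewrite mulrAC mulNr mulrC /a mul1r mulfV ?gt_eqF// mulrN1.
    by rewrite /w -powR_mulrn ?powR_ge0// -!powRrM mulrA ska powR_invn.
  rewrite powRM ?(ltW M1)// => H; apply: (le_trans dk).
  have m4 : 0 <= 4 * m by rewrite mulr_ge0// ltW.
  rewrite /C -[leRHS]mulrA; apply: (le_trans _ (ler_wpM2l m4 H)).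
  have e0 : 0 < 2 ^+ k :> R by rewrite exprn_gt0.
  rewrite exprS invfM mulrA ler_pM2r ?invr_gt0//; lra.
(* Coordinates are extended separately; the Euclidean norm then costs a factor sqrt(n). *)
have /choice[F HF] i : exists F : R -> R, (forall x, E x -> F (h x) = x ord0 i) /\
    forall u v, `|F u - F v| <= C * `|u - v| `^ a.
  have [F F1 F2] := hoelder_extension _ _ E (fun x => x ord0 i) h _ _ a01 C0 (hE i).
  by exists F.
pose f u : 'rV[R]_n := \row_i F i u.
exists (f @` [set` `[0, 1]%R]); last first.
  move=> x Ex; exists (h x); first exact: h01.
  by apply/rowP => i; rewrite mxE (HF i).1.
exists f => //; rewrite /hoelder_on01.
apply: (@le_lt_trans _ _ (Num.sqrt n%:R * C)%:E); last exact: ltry.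
apply: ge_ereal_sup => _ [u [v [_ _ uv ->]]]; rewrite lee_fin.
rewrite ler_pdivrMr ?powR_gt0 ?normr_gt0 ?subr_eq0// -mulrA.
apply: eucl_norm_le_coord; first by rewrite mulr_ge0// powR_ge0.
by move=> i; rewrite !mxE; exact: (HF i).2.
Qed.

(** * Exhaustion by countably many pieces *)

Theorem corollary1 (R : realType) (n : nat)
    (mu : {outer_measure set 'rV[R]_n -> \bar R}) (s t : R) :
  radon_measure mu ->
  1 <= s < n%:R ->
  0 <= t < s ->
  carried_by_hoelder_curves (1 / s)
    (outer_restr mu
       [set x : 'rV[R]_n |
          [/\ (0 < lower_density mu t x)%E,
              (lower_density mu t x <= upper_density mu t x)%E &
              (upper_density mu t x < +oo)%E]]).
Proof.
move=> muR /andP[s1 _] /andP[_ ts].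
(* One integer governs three parameters: [j.+1] bounds the coordinates, and its inverse is both the
   mass constant and the scale. *)
pose E (j : nat) := [set x : 'rV[R]_n |
  (forall i, `|x ord0 i| < j.+1%:R) /\
  forall r, 0 < r -> r < j.+1%:R^-1 ->
    ((j.+1%:R^-1 * r `^ t)%:E <= mu (eucl_cball x r))%E].
have /choice[G HG] j : exists G, hoelder_curve (1 / s) G /\ E j `<=` G.
  pose J : R := j.+1%:R.
  have J1 : 1 <= J by rewrite ler1n.
  have J0 : 0 < J by exact: lt_le_trans J1.
  have JV0 : 0 < J^-1 by rewrite invr_gt0.
  have JVJ : 0 < J^-1 <= J.
    by rewrite JV0 /=; apply: (le_trans _ J1); rewrite invf_le1.
  have [||G] := @sub_hoelder_curve R n mu s t J J^-1 J^-1 (E j)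
    muR s1 ts J0 JV0 JVJ.
  - by move=> x [].
  - by move=> x r [_]; apply.
  by exists G.
exists (range G); split.
- exact: card_image_le.
- by move=> _ [j _ <-]; exact: (HG j).1.
(* The pieces cover the set, so its part off the curves is empty. *)
- transitivity (mu set0); last exact: outer_measure0.
  apply: (congr1 mu).
  apply/disjoints_subset; rewrite setCK => x [/lower_densityP[c c0 [d d0 H]] _ _].
  (* [j.+1] exceeds the sum, hence each of its nonnegative terms, as membership in [E j]
     requires. *)
  pose j := Num.trunc (c^-1 + d^-1 + eucl_norm x).
  have := truncnS_gt (c^-1 + d^-1 + eucl_norm x); rewrite -/j => jlt.
  have c'0 : 0 < c^-1 by rewrite invr_gt0.
  have d'0 : 0 < d^-1 by rewrite invr_gt0.
  have x0 : 0 <= eucl_norm x by exact: sqrtr_ge0.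
  exists (G j); first by exists j.
  apply: (HG j).2; split=> [i|r r0 rj].
    by have := coord_le_eucl_norm _ _ x i; lra.
  apply: le_trans (H r r0 _); last first.
    by apply: (lt_le_trans rj); rewrite -[leRHS]invrK lef_pV2 ?posrE//; lra.
  rewrite lee_fin ler_wpM2r ?powR_ge0//.
  by rewrite -[leRHS]invrK lef_pV2 ?posrE//; lra.
Qed.
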